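(* Let $\mathcal{H}=\{rrb,bby,yyr\}$. Then $h_2(n,\mathcal{H})=\lceil n/2\rceil$ for $n\ne 7$, and $h_2(7,\mathcal{H})=3$.
   Context: Here $n$ denotes the number of vertices of the complete graph $K_n$. Edge-colorings of $K_n$ use colors from $\{r,b,y\}$ (red, blue, yellow); they need not be proper, and not all colors need be used. A pattern is an edge-colored triangle, denoted by the multiset of the colors of its three edges; e.g. $rrb$ is the triangle with two red edges and one blue edge, $bby$ has two blue edges and one yellow edge, $yyr$ has two yellow edges and one red edge. For a family $\mathcal{H}$ of patterns, $\operatorname{Forb}(n,\mathcal{H})$ is the set of all edge-colorings of $K_n$ with colors from $\{r,b,y\}$ in which no triangle has a coloring belonging to $\mathcal{H}$. For an edge-coloring $c$ of $K_n$, $h_2(c)$ is the maximum $k$ such that there is a set of $k$ vertices whose induced edges use at most two of the three colors. Finally, $h_2(n,\mathcal{H})=\min\{h_2(c): c\in\operatorname{Forb}(n,\mathcal{H})\}$.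
   Formalization: The case n = 2 is excluded from the formula, since K_2 has a single edge and so h_2(2,H) = 2, whereas ⌈2/2⌉ = 1. *)

(* Defs.v *)
From HB Require Import structures.
From mathcomp Require Import all_boot.

Set Implicit Arguments.
Unset Strict Implicit.
Unset Printing Implicit Defensive.

Inductive color := red | blue | yellow.

Definition ord_of_color (x : color) : 'I_3 :=
  match x with red => inord 0 | blue => inord 1 | yellow => inord 2 end.
Definition color_of_ord (i : 'I_3) : color :=
  match val i with 0 => red | 1 => blue | _ => yellow end.
Lemma ord_of_colorK : cancel ord_of_color color_of_ord.
Proof. by case; rewrite /color_of_ord /= inordK. Qed.

HB.instance Definition _ := Finite.copy color (can_type ord_of_colorK).

Definition edge (n : nat) := {e : {set 'I_n} | #|e| == 2}.

Definition coloring (n : nat) := {ffun edge n -> color}.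

Definition edges_in (n : nat) (S : {set 'I_n}) : {set edge n} :=
  [set e : edge n | val e \subset S].

(* A pattern is a multiset of three colors; it is encoded as a 3-tuple, and
   two patterns are compared only up to perm_eq. *)
Definition pattern := 3.-tuple color.

Definition has_pattern (n : nat) (c : coloring n) (T : {set 'I_n})
    (p : pattern) : bool :=
  perm_eq [seq c e | e in edges_in T] p.

Definition Forb (n : nat) (H : seq pattern) : {set coloring n} :=
  [set c : coloring n | [forall T : {set 'I_n},
     (#|T| == 3) ==> ~~ has (has_pattern c T) H]].

(* The empty vertex set always qualifies, so this is a genuine maximum. *)
Definition h2_coloring (n : nat) (c : coloring n) : nat :=
  \max_(S : {set 'I_n} | #|[set c e | e in edges_in S]| <= 2) #|S|.

(* Since h2_coloring c <= n for every c, the default value n does not affect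
   the minimum whenever Forb n H is nonempty. *)
Definition h2 (n : nat) (H : seq pattern) : nat :=
  \big[minn/n]_(c in Forb n H) h2_coloring c.

Definition rrb : pattern := [tuple red; red; blue].
Definition bby : pattern := [tuple blue; blue; yellow].
Definition yyr : pattern := [tuple yellow; yellow; red].

(* Main.v *)
Require Import Defs.
From mathcomp Require Import all_boot zify.

Set Implicit Arguments.
Unset Strict Implicit.
Unset Printing Implicit Defensive.

(** The forbidden patterns are exactly x, x, next x for the cyclic order
    red -> blue -> yellow -> red, so all arguments are uniform in x.

    Lower bound: the x-neighbourhood of a vertex has no edge of colour next x.
    If it has three vertices, then it contains a monochromatic triangle or forms
    one with the vertex; this happens as soon as n >= 8.  Given a triangle A
    of colour x, every vertex sends at least two edges of colour x, or at least
    two of colour next x, to A.  Two vertices of the same kind have a common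
    neighbour in A in that colour, so each of the two kinds spans at most two
    colours, and one of them has at least n/2 vertices.  For n <= 7 a largest
    monochromatic neighbourhood together with its centre is large enough.

    Upper bound: split the vertices into pairs {2k, 2k+1}; colour the pairs
    yellow, the other edges between vertices of equal parity red, and the rest
    blue.  For n = 7 colour Z/7 by the differences 1 (red), 2 (yellow),
    3 (blue): every colour class is a 7-cycle. *)

(** * The cyclic order on the colours *)

Definition next (x : color) : color :=
  match x with red => blue | blue => yellow | yellow => red end.

Lemma colorP (x y : color) : [\/ y = x, y = next x | y = next (next x)].
Proof. by case: x; case: y; constructor. Qed.

Lemma next_neq (x : color) : x <> next x.
Proof. by case: x. Qed.

Lemma next3 (x : color) : next (next (next x)) = x.
Proof. by case: x. Qed.

Lemma card_color : #|{: color}| = 3.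
Proof.
apply/eqP; rewrite eqn_leq; apply/andP; split.
  by rewrite -[X in _ <= X]card_ord (leq_card _ (can_inj ord_of_colorK)).
have /card_uniqP E : uniq [:: red; blue; yellow].
  by rewrite /= !inE !negb_or; do !(apply/andP; split) => //; apply/eqP.
by rewrite -[3]/(size [:: red; blue; yellow]) -E max_card.
Qed.

Lemma perm_eq_next (p q s x : color) :
  perm_eq [:: p; q; s] [:: x; x; next x] <->
  [\/ [/\ p = x, q = x & s = next x], [/\ p = x, s = x & q = next x]
    | [/\ q = x, s = x & p = next x]].
Proof.
split; last first.
  case=> -[-> -> ->]; apply/permP => a /=; lia.
move=> /permP h; have := h (pred1 x); have := h (pred1 (next x)) => /=.
(* Equality on [color] is inherited from ['I_3] through [inord]; [E] replaces it by a match that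
   computes. *)
have E (y z : color) : (y == z) = match y, z with
  red, red | blue, blue | yellow, yellow => true | _, _ => false end.
  by apply/eqP; case: y; case: z.
rewrite !E; case: x {h}; case: p; case: q; case: s => //= _ _;
 by [constructor 1 | constructor 2 | constructor 3].
Qed.

(** * Colourings as functions of two vertices *)

Section Colorings.
Variable n : nat.
Implicit Types (c : coloring n) (i j k v w : 'I_n) (x : color) (S : {set 'I_n}).

(* The value [red] on the diagonal is junk. *)
Definition col c i j : color :=
  if insub [set i; j] is Some e then c e else red.

Lemma col_edge c i j (e : edge n) : val e = [set i; j] -> c e = col c i j.
Proof. by move=> E; rewrite /col -E valK. Qed.

Lemma colC c i j : col c i j = col c j i.
Proof. by rewrite /col setUC. Qed.

Lemma edge_ex i j : i != j -> exists e : edge n, val e = [set i; j].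
Proof.
move=> ij; have h : #|[set i; j]| == 2 by rewrite cards2 ij.
by exists (exist (fun e : {set 'I_n} => #|e| == 2) _ h).
Qed.

Lemma edgeP (e : edge n) : exists i j, i != j /\ val e = [set i; j].
Proof. exact: (cards2P _ (valP e)). Qed.

Lemma triangle_colors c i j k : i != j -> i != k -> j != k ->
  perm_eq [seq c e | e in edges_in [set i; j; k]]
          [:: col c i j; col c i k; col c j k].
Proof.
move=> ij ik jk.
have [e1 E1] := edge_ex ij; have [e2 E2] := edge_ex ik.
have [e3 E3] := edge_ex jk.
rewrite -(col_edge c E1) -(col_edge c E2) -(col_edge c E3).
rewrite -[[:: c e1; c e2; c e3]]/(map c [:: e1; e2; e3]) /image_mem.
have edge_eqE (a b : edge n) : (a == b) = (val a == val b) by rewrite val_eqE.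
apply: perm_map; apply: uniq_perm; first exact: enum_uniq.
  rewrite /= !inE !negb_or !edge_eqE E1 E2 E3 !andbT.
  apply/andP; split; [apply/andP; split|]; apply/eqP => /setP h.
  - by move: (h j); rewrite !inE eqxx orbT (negbTE jk) eq_sym (negbTE ij).
  - by move: (h i); rewrite !inE eqxx (negbTE ij) (negbTE ik).
  - by move: (h i); rewrite !inE eqxx (negbTE ij) (negbTE ik).
move=> e; rewrite mem_enum !inE !edge_eqE E1 E2 E3.
have [a [b [ab Ee]]] := edgeP e.
rewrite {}Ee; apply/idP/idP; last first.
  case/or3P => /eqP ->; apply/subsetP => z;
    by rewrite !inE => /orP [] /eqP ->; rewrite eqxx ?orbT.
move=> /subsetP h.
have:= h a; have := h b; rewrite !inE !eqxx orbT => /(_ isT) hb /(_ isT) ha.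
move: ha hb ab; rewrite -!orbA => /or3P [] /eqP -> /or3P [] /eqP ->;
  rewrite ?eqxx ?orbT // => _; rewrite [[set _; _]]setUC eqxx ?orbT //.
Qed.

(** The two equally coloured edges meet in [i]; since all ordered triples are quantified, every
    position of the odd edge is covered. *)
Definition allowed (f : 'I_n -> 'I_n -> color) :=
  forall i j k, i != j -> i != k -> j != k ->
    f i j = f i k -> f j k <> next (f i j).

Lemma ForbP c :
  c \in Forb n [:: rrb; bby; yyr] <-> allowed (col c).
Proof.
have pat x : exists2 p : pattern, p \in [:: rrb; bby; yyr] &
    p = [:: x; x; next x] :> seq _.
  by case: x; [exists rrb|exists bby|exists yyr]; rewrite // !inE eqxx ?orbT.
rewrite inE; split.
  move=> /forallP h i j k ij ik jk e1 e2.
  move: (h [set i; j; k]).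
  have -> : #|[set i; j; k]| == 3.
    by rewrite -setUA cardsU1 cards2 jk !inE (negbTE ij) (negbTE ik).
  have [p pH pE] := pat (col c i j).
  move/hasPn => /(_ p pH); rewrite /has_pattern pE.
  rewrite (permPl (triangle_colors c ij ik jk)) => /negP; apply.
  by apply/perm_eq_next; constructor 1; rewrite -e1.
move=> h; apply/forallP => T; apply/implyP => /eqP T3.
have /card_gt2P [i [j [k [[iT jT kT] [ij jk ki]]]]] : 2 < #|T| by rewrite T3.
have ik : i != k by rewrite eq_sym.
have {T3 iT jT kT} -> : T = [set i; j; k].
  apply/esym/eqP; rewrite eqEcard T3 -setUA cardsU1 cards2 jk !inE.
  rewrite (negbTE ij) (negbTE ik) andbT.
  by apply/subsetP => z; rewrite !inE => /or3P [] /eqP ->.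
apply/hasPn => p pH.
have [x pE] : exists x, p = [:: x; x; next x] :> seq _.
  by move: pH; rewrite !inE => /or3P [] /eqP ->;
    [exists red|exists blue|exists yellow].
rewrite /has_pattern pE (permPl (triangle_colors c ij ik jk)).
apply/negP => /perm_eq_next [] [e1 e2 e3].
- by apply: (h i j k) => //; rewrite ?e1 ?e2.
- apply: (h j i k) => //; rewrite 1?eq_sym // 1?(colC c j i) ?e1 ?e2 //.
- apply: (h k i j) => //; rewrite 1?eq_sym // 1?(colC c k i) 1?(colC c k j).
    by rewrite e1 e2.
  by rewrite e1.
Qed.

(** * Vertex sets missing a colour *)

Definition misses c x S := forall i j, i \in S -> j \in S -> i != j -> col c i j <> x.

Lemma two_coloredP c S :
  #|[set c e | e in edges_in S]| <= 2 <-> exists x, misses c x S.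
Proof.
split.
  move=> h; have /subsetPn [x _ xN] : ~~ ([set: color] \subset
      [set c e | e in edges_in S]).
    by apply/negP => /subset_leq_card /leq_trans /(_ h); rewrite cardsT card_color.
  exists x => i j iS jS ij E; case/negP: xN.
  have [e Ee] := edge_ex ij; apply/imsetP; exists e; last first.
    by rewrite (col_edge c Ee).
  by rewrite inE Ee; apply/subsetP => z; rewrite !inE => /orP [] /eqP ->.
case=> x h; rewrite -ltnS -[X in _ < X]card_color -cardsT proper_card //.
rewrite properT; apply/eqP => /setP /(_ x); rewrite inE => /imsetP [e].
rewrite inE => /subsetP eS xE; have [i [j [ij Ee]]] := edgeP e.
apply: (h i j) => //; last by rewrite -(col_edge c Ee).
  by apply: eS; rewrite Ee !inE eqxx.
by apply: eS; rewrite Ee !inE eqxx orbT.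
Qed.

Lemma h2_coloring_ge c x S : misses c x S -> #|S| <= h2_coloring c.
Proof.
move=> h; apply: (@leq_bigmax_cond _ _ (fun S : {set 'I_n} => #|S|) S).
by apply/two_coloredP; exists x.
Qed.

Lemma h2_coloring_le c m :
  (forall x S, misses c x S -> #|S| <= m) -> h2_coloring c <= m.
Proof. by move=> h; apply/bigmax_leqP => S /two_coloredP [x]; apply: h. Qed.

(** * Lower bound from neighbourhoods *)

Definition nbhd c x v : {set 'I_n} := [set w | (w != v) && (col c v w == x)].

(** An edge of colour [next x] between two [x]-neighbours would close a forbidden triangle with [v];
    the edges at [v] itself have colour [x]. *)
Lemma misses_nbhd c x v : allowed (col c) ->
  misses c (next x) (v |: nbhd c x v).
Proof.
move=> h i j; rewrite !inE.
case/orP => [/eqP ->|/andP [iv /eqP xi]]; case/orP => [/eqP ->|/andP [jv /eqP xj]].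
- by rewrite eqxx.
- by rewrite xj => _; apply: next_neq.
- by rewrite colC xi => _; apply: next_neq.
- by move=> ij; have := h v i j; rewrite 1?eq_sym iv 1?eq_sym jv ij xi xj; apply.
Qed.

Lemma nbhd_large c v : exists x, n.-1 <= 3 * #|nbhd c x v|.
Proof.
have sub : [set~ v] \subset
   nbhd c red v :|: nbhd c blue v :|: nbhd c yellow v.
  apply/subsetP => w; rewrite !inE => -> /=.
  by case: (col c v w); rewrite eqxx ?orbT.
have h : n.-1 <= #|nbhd c red v| + #|nbhd c blue v| + #|nbhd c yellow v|.
  rewrite -[X in X.-1](card_ord n) -(cardsC1 v).
  apply: leq_trans (subset_leq_card sub) _.
  apply: leq_trans (leq_card_setU _ _).1 _.
  by rewrite leq_add2r; apply: (leq_card_setU _ _).1.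
case: (leqP n.-1 (3 * #|nbhd c red v|)) => [|a]; first by exists red.
case: (leqP n.-1 (3 * #|nbhd c blue v|)) => [|b]; first by exists blue.
exists yellow; lia.
Qed.

(** The centre adds one vertex to a neighbourhood of size at least (n - 1)/3. This yields [uphalf n]
    for 0 < n <= 6, and 3 for n = 7. *)
Lemma h2_coloring_nbhd c : allowed (col c) -> 0 < n ->
  n.+2 <= 3 * h2_coloring c.
Proof.
move=> h n0; have [x hx] := nbhd_large c (Ordinal n0).
suff : #|nbhd c x (Ordinal n0)| < h2_coloring c by lia.
apply: leq_trans (h2_coloring_ge (misses_nbhd (x := x) (v := Ordinal n0) h)).
by rewrite cardsU1 !inE eqxx.
Qed.

(** * Lower bound from a monochromatic triangle *)

Definition mono c x i j k :=
  [/\ i != j, i != k & j != k] /\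
  [/\ col c i j = x, col c i k = x & col c j k = x].

Lemma mono_exists c : allowed (col c) -> 8 <= n ->
  exists x i j k, mono c x i j k.
Proof.
move=> h n8; have n0 : 0 < n by lia.
pose v := Ordinal n0; have [x hx] := nbhd_large c v.
(* Since [n.-1] is at least 7, a third of it exceeds 2. *)
have /card_gt2P [i [j [k [[iN jN kN] [ij jk ki]]]]] : 2 < #|nbhd c x v| by lia.
have mis := @misses_nbhd c x v h.
move: (iN) (jN) (kN); rewrite !inE => /andP [iv /eqP xi] /andP [jv /eqP xj] /andP [kv /eqP xk].
have D a b : a \in nbhd c x v -> b \in nbhd c x v -> a != b ->
    col c a b = x \/ col c a b = next (next x).
  move=> aN bN ab; case: (colorP x (col c a b)); [by left| |by right].
  by move=> E; case: (mis a b); rewrite // inE ?aN ?bN orbT.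
have ik : i != k by rewrite eq_sym.
(* An edge of colour [x] among [i], [j], [k] forms a triangle with [v]; otherwise all three edges
   have colour [next (next x)]. *)
have [E|E1] := D i j iN jN ij.
  by exists x, v, i, j; split; split; rewrite // eq_sym.
have [E|E2] := D i k iN kN ik.
  by exists x, v, i, k; split; split; rewrite // eq_sym.
have [E|E3] := D j k jN kN jk.
  by exists x, v, j, k; split; split; rewrite // eq_sym.
by exists (next (next x)), i, j, k.
Qed.

Definition two_of c y i j k : {set 'I_n} :=
  [set w | [|| (w \in nbhd c y i) && (w \in nbhd c y j),
               (w \in nbhd c y i) && (w \in nbhd c y k)
             | (w \in nbhd c y j) && (w \in nbhd c y k)]].

(** Two pairs chosen from [i], [j], [k] always meet, so any two members have a common [y]-neighbour
    [z], and [misses_nbhd] applies at [z]. *)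
Lemma misses_two_of c y i j k : allowed (col c) ->
  misses c (next y) (two_of c y i j k).
Proof.
move=> h w w' wS w'S ww'.
suff [z wz w'z] : exists2 z, w \in nbhd c y z & w' \in nbhd c y z.
  by apply: (misses_nbhd (x := y) (v := z) h) => //; rewrite inE ?wz ?w'z orbT.
move: wS w'S; rewrite ![_ \in two_of _ _ _ _ _]inE.
case/or3P => /andP [a b]; case/or3P => /andP [a' b'];
  by [exists i | exists j | exists k].
Qed.

(** For [w] outside the triangle, at most one of its three edges to the triangle has colour
    [next (next x)], and [x] and [next x] do not both occur. Hence two of the edges agree in [x] or
    in [next x]. The triangle's own vertices lie in the first set. *)
Lemma two_of_cover c x i j k : allowed (col c) -> mono c x i j k ->
  two_of c x i j k :|: two_of c (next x) i j k = setT.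
Proof.
move=> h [[ij ik jk] [xij xik xjk]]; apply/setP => w; rewrite !inE.
have ji : j != i by rewrite eq_sym.
have ki : k != i by rewrite eq_sym.
have kj : k != j by rewrite eq_sym.
have [->|wi] := eqVneq w i.
  by rewrite ij ik (colC c j) (colC c k) xij xik eqxx /= ?orbT.
have [->|wj] := eqVneq w j.
  by rewrite jk (colC c k) xij xjk eqxx /= ?orbT.
have [->|wk] := eqVneq w k.
  by rewrite xik xjk eqxx /= ?orbT.
have P a b : a != b -> w != a -> w != b -> col c a b = x ->
    (col c a w = x -> col c b w <> next x) /\
    (col c a w = next (next x) -> col c b w <> next (next x)).
  move=> ab wa wb xab; have aw : a != w by rewrite eq_sym.
  have bw : b != w by rewrite eq_sym.
  split=> [e e'|e e'].
    by apply: (h a b w) => //; rewrite xab ?e ?e'.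
  apply: (h w a b) => //; first by rewrite colC e colC e'.
  by rewrite xab colC e next3.
have [P1 P2] := P i j ij wi wj xij.
have [P3 P4] := P i k ik wi wk xik.
have [P5 P6] := P j k jk wj wk xjk.
have ij' : col c j i = x by rewrite colC.
have ik' : col c k i = x by rewrite colC.
have jk' : col c k j = x by rewrite colC.
(* The first half of [P] is not symmetric in its two endpoints, so it is also used with them
   swapped. *)
have [Q1 _] := P j i ji wj wi ij'.
have [Q3 _] := P k i ki wk wi ik'.
have [Q5 _] := P k j kj wk wj jk'.
have [ai|ai|ai] := colorP x (col c i w);
have [aj|aj|aj] := colorP x (col c j w);
have [ak|ak|ak] := colorP x (col c k w);
rewrite ?ai ?aj ?ak ?eqxx /= ?orbT //; exfalso;
  by [apply: P1|apply: P2|apply: P3|apply: P4|apply: P5|apply: P6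
     |apply: Q1|apply: Q3|apply: Q5].
Qed.

Lemma h2_coloring_mono c x i j k : allowed (col c) -> mono c x i j k ->
  n <= 2 * h2_coloring c.
Proof.
move=> h m.
have := h2_coloring_ge (@misses_two_of c x i j k h).
have := h2_coloring_ge (@misses_two_of c (next x) i j k h).
have [+ _] := leq_card_setU (two_of c x i j k) (two_of c (next x) i j k).
rewrite (two_of_cover h m) cardsT card_ord; lia.
Qed.

Lemma h2_coloring_lower c : allowed (col c) -> n <> 7 ->
  uphalf n <= h2_coloring c.
Proof.
move=> h n7; have [n8|n8] := leqP 8 n.
  have [x [i [j [k m]]]] := mono_exists h n8.
  have := h2_coloring_mono h m; lia.
have [n0|n0] := posnP n; first by lia.
have := h2_coloring_nbhd h n0; lia.
Qed.

(** * Colourings from symmetric functions *)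

Definition coloring_of (f : 'I_n -> 'I_n -> color) : coloring n :=
  [ffun e : edge n => if enum (val e) is [:: i; j] then f i j else red].

(** [enum] may list the endpoints in either order; the symmetry of [f] makes this harmless. *)
Lemma col_coloring_of f i j : (forall i j, f i j = f j i) -> i != j ->
  col (coloring_of f) i j = f i j.
Proof.
move=> fC ij; have [e Ee] := edge_ex ij.
rewrite -(col_edge _ Ee) ffunE Ee.
have : perm_eq (enum [set i; j]) [:: i; j].
  apply: uniq_perm; first exact: enum_uniq.
    by rewrite /= inE ij.
  by move=> z; rewrite mem_enum !inE.
move=> p; move: (perm_size p) (perm_uniq p) (perm_mem p).
case: (enum _) => [|a [|b [|? ?]]] //= _; rewrite !inE ij !andbT => ab m.
move: ab (m a) (m b); rewrite !inE !eqxx orbT /=.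
move=> ab /esym/orP [] /eqP Ea /esym/orP [] /eqP Eb; move: ab;
  by rewrite Ea Eb ?eqxx.
Qed.

Lemma allowed_coloring_of f : (forall i j, f i j = f j i) -> allowed f ->
  allowed (col (coloring_of f)).
Proof. by move=> fC h i j k ij ik jk; rewrite !col_coloring_of //; apply: h. Qed.

End Colorings.

(** * Bounds on the minimum [h2] *)

Lemma bigminn_le (I : finType) (P : pred I) (F : I -> nat) m (j : I) : P j ->
  \big[minn/m]_(i | P i) F i <= F j.
Proof.
move=> Pj; have : j \in index_enum I by rewrite mem_index_enum.
elim: (index_enum I) => //= a s IH; rewrite inE big_cons => /orP [/eqP <-|/IH h].
  by rewrite Pj geq_minl.
by case: ifP => // _; rewrite geq_min h orbT.
Qed.

(** The assumption [m <= n] takes care of the default value [n] of the minimum. *)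
Lemma h2_lower n m : m <= n ->
  (forall c : coloring n, allowed (col c) -> m <= h2_coloring c) ->
  m <= h2 n [:: rrb; bby; yyr].
Proof.
move=> mn h; rewrite /h2; elim/big_ind: _ => // [a b|c /ForbP /h //].
by rewrite leq_min => -> ->.
Qed.

Lemma h2_upper n (f : 'I_n -> 'I_n -> color) m :
  (forall i j, f i j = f j i) -> allowed f ->
  (forall x (S : {set 'I_n}),
     (forall i j, i \in S -> j \in S -> i != j -> f i j <> x) -> #|S| <= m) ->
  h2 n [:: rrb; bby; yyr] <= m.
Proof.
move=> fC fA h; have /ForbP cF := allowed_coloring_of fC fA.
apply: leq_trans (bigminn_le _ _ cF) _.
apply: h2_coloring_le => x S hS; apply: (h x) => i j iS jS ij.
by rewrite -(col_coloring_of fC ij); apply: hS.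
Qed.

(** * Upper bound by pairing *)

Definition pair_color n (i j : 'I_n) : color :=
  if i./2 == j./2 then yellow else if odd i == odd j then red else blue.

Lemma pair_colorC n (i j : 'I_n) : pair_color i j = pair_color j i.
Proof. by rewrite /pair_color eq_sym [odd i == _]eq_sym. Qed.

(** Two red edges at a vertex join vertices of one parity, so the third edge is not blue. Two blue
    edges lead to vertices of equal parity, which are never a pair. Yellow edges are disjoint. *)
Lemma pair_color_allowed n : allowed (@pair_color n).
Proof.
move=> i j k; rewrite -!(inj_eq val_inj) /= /pair_color => ij ik jk.
do 3 (case: eqP => ?; last first); try (exfalso; lia).
all: by do ?[case: eqP => ?]; try (exfalso; lia).
Qed.

Lemma h2_upper_half n : n <> 2 -> h2 n [:: rrb; bby; yyr] <= uphalf n.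
Proof.
move=> n2; apply: (h2_upper (@pair_colorC n) (@pair_color_allowed n)) => x S h.
have [n3|n3] := leqP n 2.
  by apply: (leq_trans (max_card _)); rewrite card_ord; lia.
have half_lt (i : 'I_n) : i./2 < uphalf n by have := ltn_ord i; lia.
have [/dinjectiveP inj|/dinjectivePn [i iS [j]]] :=
  boolP (dinjectiveb (fun i => Ordinal (half_lt i)) S).
  by rewrite -(card_in_imset inj) (leq_trans (max_card _)) // card_ord.
rewrite !inE => /andP [ji jS] /(congr1 val) /= ijE.
(* Here [n] is at least 3, so [uphalf n] is at least 2. *)
have [S2|S3] := leqP #|S| 2; first by apply: leq_trans S2 _; lia.
(* A third vertex shares its parity with exactly one vertex of the yellow pair, so it sends one red
   and one blue edge to it: no colour is missing. *)
have /subsetPn [k kS] : ~~ (S \subset [set i; j]).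
  apply/negP => /subset_leq_card; rewrite leqNgt (leq_ltn_trans _ S3) //.
  by rewrite cards2; case: eqP.
rewrite !inE negb_or => /andP [ki kj].
have := h k j kS jS kj; have := h k i kS iS ki; have := h j i jS iS ji.
move: ki kj ji; rewrite -!(inj_eq val_inj) /= /pair_color ijE eqxx.
case: (k./2 =P j./2) => ? ki kj ji; first by exfalso; lia.
have : odd i != odd j by lia.
by case: x {h}; case: (odd i); case: (odd j); case: (odd k).
Qed.

(** * Upper bound for seven vertices *)

Definition fano_step (x : color) : nat :=
  match x with red => 1 | yellow => 2 | blue => 3 end.

(** Adding 7 keeps the subtraction from truncating. The default branch covers the differences 3 and
    4, and a junk value on the diagonal. *)
Definition fano_color (i j : 'I_7) : color :=
  match (i + 7 - j) %% 7 with
  | 1 | 6 => red | 2 | 5 => yellow | _ => blue end.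

Lemma fano_colorC i j : fano_color i j = fano_color j i.
Proof.
by move: i j => [[|[|[|[|[|[|[|?]]]]]]] hi] [[|[|[|[|[|[|[|?]]]]]]] hj].
Qed.

(** Up to sign, doubling modulo 7 sends 1 to 2, 2 to 3 and 3 to 1, so two edges of colour [x] at a
    vertex span an edge of colour [next (next x)]. The proof checks all triples by computation. *)
Lemma fano_color_allowed : allowed fano_color.
Proof.
by move=> [[|[|[|[|[|[|[|?]]]]]]] hi] [[|[|[|[|[|[|[|?]]]]]]] hj]
  [[|[|[|[|[|[|[|?]]]]]]] hk].
Qed.

Lemma h2_7_upper : h2 7 [:: rrb; bby; yyr] <= 3.
Proof.
apply: (h2_upper fano_colorC fano_color_allowed) => x S h.
(* S and its translate by the step of the missing colour are disjoint. *)
pose t (i : 'I_7) : 'I_7 := inord ((i + fano_step x) %% 7).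
have tE i : t i = (i + fano_step x) %% 7 :> nat by rewrite inordK // ltn_mod.
have t_inj : injective t.
  move=> i j /(congr1 val); rewrite /= !tE => E; apply: val_inj => /=.
  have := ltn_ord i; have := ltn_ord j; move: E; case: (x) => /=; lia.
have dis : [disjoint S & t @: S].
  rewrite disjoint_sym; apply/pred0P => j /=; apply/negP.
  case/andP => /imsetP [i iS ->] tS; apply: (h i (t i)) => //.
    rewrite -(inj_eq val_inj) /= tE; have := ltn_ord i.
    by case: (x) => /=; lia.
  rewrite /fano_color tE.
  by move: i {iS tS} => [[|[|[|[|[|[|[|?]]]]]]] hi]; case: (x).
move: dis; rewrite -(leq_card_setU S (t @: S)).2 (card_imset _ t_inj) addnn.
move=> /eqP E; rewrite -ltnS -ltn_double -E.
by apply: leq_ltn_trans (max_card _) _; rewrite card_ord.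
Qed.

(** The formula fails at n = 2: two vertices span a single edge, so the minimum is 2, while
    [uphalf 2] is 1. *)
Theorem lemma3p3 :
  (forall n : nat, n <> 2 -> n <> 7 -> h2 n [:: rrb; bby; yyr] = uphalf n) /\
  h2 7 [:: rrb; bby; yyr] = 3.
Proof.
split=> [n n2 n7|]; apply/eqP; rewrite eqn_leq.
  rewrite h2_upper_half //=; apply: h2_lower => [|c h]; first by lia.
  exact: h2_coloring_lower.
rewrite h2_7_upper /=; apply: h2_lower => // c h.
by have := h2_coloring_nbhd h isT; lia.
Qed.
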